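(* If $X$ is a Polish space, $\mu\colon\mathcal B(X)\to[0,\infty]$ is a free $\sigma$-finite measure and $\mu(X)>0$, then $\mathcal N(\mu)=_{\mathrm T}\mathcal N(\mathbb R)$ and $\mathsf{Cv}_{\mathcal N(\mu)}=_{\mathrm T}\mathsf{Cv}_{\mathcal N(\mathbb R)}$. In particular, $\mathrm{add}(\mathcal N(\mu))=\mathrm{add}(\mathcal N(\mathbb R))$, $\mathrm{cof}(\mathcal N(\mu))=\mathrm{cof}(\mathcal N(\mathbb R))$, $\mathrm{non}(\mathcal N(\mu))=\mathrm{non}(\mathcal N(\mathbb R))$ and $\mathrm{cov}(\mathcal N(\mu))=\mathrm{cov}(\mathcal N(\mathbb R))$.
   Context: A Polish space is a completely metrizable separable topological space; $\mathcal B(X)$ is its Borel $\sigma$-algebra. A measure is free if every singleton is measurable with measure $0$. For a measure $\mu$ on a $\sigma$-algebra $\mathcal A$ over $X$, $\mathcal N(\mu)=\{N\subseteq X:\exists A\in\mathcal A\ (N\subseteq A,\ \mu(A)=0)\}$; $\mathcal N(\mathbb R)$ is the ideal of Lebesgue null subsets of $\mathbb R$. A relational system is a triple $R=\langle X,Y,\lhd\rangle$ with $X,Y$ non-empty sets and $\lhd$ a relation. For $R=\langle X,Y,\lhd\rangle$ and $S=\langle Z,W,\sqsubset\rangle$, $R\leq_{\mathrm T}S$ means that there are functions $\psi_-\colon X\to Z$ and $\psi_+\colon W\to Y$ such that, for all $x\in X$ and $w\in W$, $\psi_-(x)\sqsubset w$ implies $x\lhd\psi_+(w)$. $R=_{\mathrm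 T}S$ (Tukey equivalence) means $R\leq_{\mathrm T}S$ and $S\leq_{\mathrm T}R$. An ideal $\mathcal I$ on a set $X$ is regarded as the relational system $\langle\mathcal I,\mathcal I,\subseteq\rangle$, and $\mathsf{Cv}_{\mathcal I}=\langle X,\mathcal I,\in\rangle$. For an ideal $\mathcal I$ on $X$: $\mathrm{add}(\mathcal I)=\min\{|\mathcal F|:\mathcal F\subseteq\mathcal I,\ \bigcup\mathcal F\notin\mathcal I\}$, $\mathrm{cov}(\mathcal I)=\min\{|\mathcal F|:\mathcal F\subseteq\mathcal I,\ \bigcup\mathcal F=X\}$, $\mathrm{non}(\mathcal I)=\min\{|Y|:Y\subseteq X,\ Y\notin\mathcal I\}$, $\mathrm{cof}(\mathcal I)=\min\{|\mathcal F|:\mathcal F\subseteq\mathcal I,\ \forall A\in\mathcal I\ \exists B\in\mathcal F\ (A\subseteq B)\}$. *)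

(* Defs.v *)
From mathcomp Require Import all_boot all_order all_algebra.
From mathcomp Require Import all_classical all_reals all_analysis.

Set Implicit Arguments.
Unset Strict Implicit.
Unset Printing Implicit Defensive.

Import Order.TTheory GRing.Theory Num.Theory.

Local Open Scope classical_set_scope.
Local Open Scope card_scope.
Local Open Scope ring_scope.

Definition is_metric (R : realType) (T : Type) (d : T -> T -> R) : Prop :=
  [/\ forall x y, 0 <= d x y,
      forall x y, d x y = 0 <-> x = y,
      forall x y, d x y = d y x
    & forall x y z, d x z <= d x y + d y z].

Definition induces_topology (R : realType) (T : topologicalType)
    (d : T -> T -> R) : Prop :=
  forall x : T,
    nbhs x = filter_from [set e : R | 0 < e] (fun e => [set y | d x y < e]).

(* The limit is taken in the topology of T; this is used only for metrics that
   induce that topology. *)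
Definition metric_complete (R : realType) (T : topologicalType)
    (d : T -> T -> R) : Prop :=
  forall u : nat -> T,
    (forall e : R, 0 < e -> exists N : nat, forall m n : nat,
        (N <= m)%N -> (N <= n)%N -> d (u m) (u n) < e) ->
    exists l : T, u @ \oo --> l.

Definition completely_metrizable (R : realType) (T : topologicalType) : Prop :=
  exists d : T -> T -> R,
    [/\ is_metric d, induces_topology d & metric_complete d].

Definition separable (T : topologicalType) : Prop :=
  exists2 S : set T, countable S & dense S.

Definition polish (R : realType) (T : topologicalType) : Prop :=
  completely_metrizable R T /\ separable T.

(* measurableType is pointed, hence so is the underlying space. *)
Notation borelType T := (g_sigma_algebraType (@open T)).

Definition free_measure (d : measure_display) (T : measurableType d)
    (R : realType) (mu : {measure set T -> \bar R}) : Prop :=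
  forall x : T, measurable [set x] /\ mu [set x] = 0%E.

Record ideal (T : Type) := Ideal {
  ideal_sets : set (set T);
  ideal_set0 : ideal_sets set0;
  ideal_subset : forall A B : set T, A `<=` B -> ideal_sets B -> ideal_sets A;
  ideal_setU : forall A B : set T,
    ideal_sets A -> ideal_sets B -> ideal_sets (A `|` B) }.

Definition null_ideal (d : measure_display) (T : measurableType d)
    (R : realType) (mu : {measure set T -> \bar R}) : ideal T :=
  @Ideal T mu.-negligible (negligible_set0 mu)
    (fun A B => @negligibleS d T R mu B A) (@negligibleU d T R mu).

Record relsys := RelSys {
  challenge : Type;
  response : Type;
  meets : challenge -> response -> Prop;
  challenge_inhabited : inhabited challenge;
  response_inhabited : inhabited response }.

Definition tukey_le (A B : relsys) : Prop :=
  exists (psi_m : challenge A -> challenge B)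
         (psi_p : response B -> response A),
    forall (x : challenge A) (w : response B),
      meets (psi_m x) w -> meets x (psi_p w).

Definition tukey_eq (A B : relsys) : Prop := tukey_le A B /\ tukey_le B A.

Lemma ideal_inhabited (T : Type) (I : ideal T) :
  inhabited (set_type (ideal_sets I)).
Proof. by split; exists set0; rewrite inE; exact: ideal_set0. Qed.

Definition ideal_relsys (T : Type) (I : ideal T) : relsys :=
  @RelSys (set_type (ideal_sets I)) (set_type (ideal_sets I))
    (fun A B => val A `<=` val B) (ideal_inhabited I) (ideal_inhabited I).

Definition Cv (T : pointedType) (I : ideal T) : relsys :=
  @RelSys T (set_type (ideal_sets I)) (fun x A => val A x)
    (inhabits point) (ideal_inhabited I).

(* MathComp-Analysis has no type of cardinal numbers: a cardinal is given by a
   set kappa, considered up to #=. [is_min_card P kappa] says that the minimum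
   of the cardinals |F|, for F in the class P, exists and equals |kappa|. *)
Definition is_min_card (U K : Type) (P : set (set U)) (kappa : set K) : Prop :=
  (exists2 F : set U, P F & F #= kappa) /\
  (forall F : set U, P F -> kappa #<= F).

(* [is_add I kappa] reads add(I) = |kappa|, and similarly for the other three. *)
Definition is_add (T K : Type) (I : ideal T) (kappa : set K) : Prop :=
  is_min_card
    [set F : set (set T) | F `<=` ideal_sets I /\
       ~ ideal_sets I (\bigcup_(A in F) A)] kappa.

Definition is_cov (T K : Type) (I : ideal T) (kappa : set K) : Prop :=
  is_min_card
    [set F : set (set T) | F `<=` ideal_sets I /\ \bigcup_(A in F) A = setT] kappa.

Definition is_non (T K : Type) (I : ideal T) (kappa : set K) : Prop :=
  is_min_card [set Y : set T | ~ ideal_sets I Y] kappa.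

Definition is_cof (T K : Type) (I : ideal T) (kappa : set K) : Prop :=
  is_min_card
    [set F : set (set T) | F `<=` ideal_sets I /\
       forall A : set T, ideal_sets I A -> exists2 B : set T, F B & A `<=` B] kappa.

(* Main.v *)
From HB Require Import structures.
Require Import Defs.
From mathcomp Require Import all_boot all_order all_algebra.
From mathcomp Require Import all_classical all_reals all_analysis.
From mathcomp Require Import measurable_realfun lra.

(* Both null ideals are identified with that of Lebesgue measure on ]0, 1[ by
   maps [f], [g] that pull null sets back to null sets and are inverse to each
   other off null sets ([null_iso]). Such maps yield all the Tukey connections:
   send a null set [A] to [g^-1(A)], and [B] back to [f^-1(B)] together with the
   null set where [g o f] is not the identity.

   A nonzero sigma-finite measure has the null sets of some probability. A Polish
   space is Borel isomorphic to a Borel subset of the line: code a point by the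
   set of basic balls containing it, read as ternary digits; by completeness the
   codes of points are exactly the sets of balls satisfying countably many Borel
   conditions, so that no analytic set is involved. Finally an atomless
   probability on the line is identified with Lebesgue measure on ]0, 1[ by its
   distribution function [F] and the quantile function [G]: [F (G t) = t], and [G]
   transports Lebesgue measure to the given probability, so that [G (F r) = r] for
   almost all [r], although [F] need not be injective. *)

Import Order.TTheory GRing.Theory Num.Theory numFieldNormedType.Exports.

Local Open Scope classical_set_scope.
Local Open Scope card_scope.
Local Open Scope ring_scope.

(** * Cardinal invariants of Tukey equivalent ideals *)

Lemma le_card_inj {T U : Type} {A : set T} {B : set U} (f : T -> U) :
  f @` A `<=` B -> {in A &, injective f} -> A #<= B.
Proof.
move=> fAB finj; apply: (card_le_trans (B := f @` A)); last exact: subset_card_le.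
by have := inj_card_eq finj; rewrite card_eq_sym card_eq_le => /andP[].
Qed.

(* A maximal set [M] of choice functions that are pairwise different at every
   member of [P] takes all values at some [F]: otherwise it could be enlarged.
   Then [F] is in bijection with [M], which injects into every member of [P]. *)
Lemma exists_min_card {U : Type} {P : set (set U)} :
  P !=set0 -> exists2 F, P F & forall G, P G -> F #<= G.
Proof.
move=> [F0 PF0]; have [P0|nP0] := pselect (P set0).
  by exists set0 => // G _; exact: card_ge0.
have ne F : P F -> exists u, F u.
  move=> PF; apply/not_existsP => Fe; apply: nP0.
  by rewrite (_ : set0 = F)//; apply/esym/seteqP; split => // u /Fe.
have [u0 _] := ne _ PF0.
pose coherent (M : set (set U -> U)) :=
  (forall a F, M a -> P F -> F (a F)) /\
  (forall a b F G, M a -> M b -> P F -> P G -> a F = b F -> a G = b G).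
have [|M [[Mch Mdiff] Mmax]] := Zorn_bigcup (P := coherent).
  move=> C Ccoh Ctot; split.
    by move=> a F [M CM Ma]; have [+ _] := Ccoh _ CM; exact.
  move=> a b F G [M CM Ma] [N CN Nb]; have [MN|NM] := Ctot _ _ CM CN.
    by have [_] := Ccoh _ CN; apply => //; exact: MN.
  by have [_] := Ccoh _ CM; apply => //; exact: NM.
have [F PF hitF] : exists2 F, P F & forall u, F u -> exists2 a, M a & a F = u.
  apply: contrapT => nF.
  have /choice[b bP] : forall F, exists u, P F -> F u /\ forall a, M a -> a F <> u.
    move=> F; have [PF|nPF] := pselect (P F); last by exists u0.
    apply: contrapT => nu; apply: nF; exists F => // u Fu.
    apply: contrapT => na; apply: nu; exists u => _; split=> // a Ma aFu.
    by apply: na; exists a.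
  apply: (Mmax (M `|` [set b])).
    split=> [|MbM]; first exact: subsetUl.
    by have [_ /(_ b (MbM b (or_intror erefl)))] := bP _ PF0.
  split=> [a F [Ma|->] PF|a c F G [Ma|->] [Mc|->] PF PG] //.
  - exact: Mch Ma PF.
  - by have [] := bP _ PF.
  - exact: Mdiff Ma Mc PF PG.
  - by have [_ /(_ _ Ma)] := bP _ PF.
  - by have [_ /(_ _ Mc)] := bP _ PF => /[swap] ->.
exists F => // G PG.
have /choice[c cP] : forall u, exists a, F u -> M a /\ a F = u.
  move=> u; have [/hitF[a Ma aF]|nFu] := pselect (F u); first by exists a.
  by exists (fun=> u0).
apply: (le_card_inj (fun u => c u G)).
  by move=> _ [u /cP[Mc _] <-]; exact: Mch Mc PG.
move=> u v /set_mem Fu /set_mem Fv.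
have [Mu {2}<-] := cP u Fu; have [Mv {2}<-] := cP v Fv.
exact: Mdiff Mu Mv PG PF.
Qed.

(** A least member of [P] serves for both classes: it lies below every member of [Q] because each of
    these dominates a member of [P], and some member of [Q] lies below it. *)
Lemma exists_common_min_card {T U : Type} {P : set (set T)} {Q : set (set U)} :
  P !=set0 ->
  (forall F, P F -> exists2 G, Q G & G #<= F) ->
  (forall G, Q G -> exists2 F, P F & F #<= G) ->
  exists kappa : set T, is_min_card Q kappa /\ is_min_card P kappa.
Proof.
move=> /exists_min_card[F PF Fmin] PQ QP; exists F.
have FQ G : Q G -> F #<= G.
  by move=> /QP[F' PF' F'G]; exact: card_le_trans (Fmin _ PF') F'G.
split; split=> //; last by exists F.
have [G QG GF] := PQ _ PF.
by exists G => //; rewrite card_eq_le GF FQ.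
Qed.

(** Tukey maps act on the subtype of members of an ideal. A total extension, with default [u0], lets
    families of sets be transported as images. *)
Lemma set_type_fun {T U : Type} {A : set T} {B : set U} (f : A -> B) (u0 : U) :
  exists2 g : T -> U, (forall x, A x -> B (g x)) &
    forall x : A, g (val x) = val (f x).
Proof.
pose g x := if pselect (A x) is left Ax then val (f (SigSub (mem_set Ax))) else u0.
exists g => [x Ax|[x xA]]; rewrite /g /=.
  by case: pselect => // Ax'; apply: set_mem; exact: (valP (f _)).
case: pselect => [Ax|/(_ (set_mem xA))//].
by congr (val (f _)); exact: val_inj.
Qed.

(** * Transport of families along Tukey connections *)

Section tukey_cardinals.
Context {T U : pointedType} {I : ideal T} {J : ideal U}.

(** The family is the image of [F] under [pm]: if its union were in [J], the answer of [pp] to that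
    union would be a member of [I] containing all members of [F]. *)
Lemma tukey_add_family (F : set (set T)) :
  tukey_le (ideal_relsys I) (ideal_relsys J) ->
  F `<=` ideal_sets I -> ~ ideal_sets I (\bigcup_(A in F) A) ->
  exists2 G : set (set U), G `<=` ideal_sets J /\
    ~ ideal_sets J (\bigcup_(A in G) A) & G #<= F.
Proof.
move=> [/= pm [pp ppP]] FI FnI.
have [g gJ gE] := set_type_fun pm set0.
exists (g @` F); last exact: card_image_le.
split=> [_ [A /FI IA <-]|JG]; first exact: gJ.
apply: FnI; apply: (@ideal_subset _ _ _ (val (pp (SigSub (mem_set JG))))).
  move=> x [A FA Ax]; have IA := FI _ FA.
  apply: (ppP (SigSub (mem_set IA))) => //= y.
  by rewrite -gE /= => gAy; exists (g A) => //; exists A.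
by apply: set_mem; exact: (valP (pp _)).
Qed.

(** Here families move backwards, along [pp]: a member of [G] that meets the challenge [pm A] yields
    a set containing [A]. *)
Lemma tukey_cof_family (G : set (set U)) :
  tukey_le (ideal_relsys I) (ideal_relsys J) ->
  G `<=` ideal_sets J ->
  (forall A, ideal_sets J A -> exists2 B, G B & A `<=` B) ->
  exists2 F : set (set T), F `<=` ideal_sets I /\
    (forall A, ideal_sets I A -> exists2 B, F B & A `<=` B) & F #<= G.
Proof.
move=> [/= pm [pp ppP]] GJ Gcof.
have [g gI gE] := set_type_fun pp set0.
exists (g @` G); last exact: card_image_le.
split=> [_ [A /GJ JA <-]|A IA]; first exact: gI.
have JA : ideal_sets J (val (pm (SigSub (mem_set IA)))).
  by apply: set_mem; exact: (valP (pm _)).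
have [B GB AB] := Gcof _ JA; have JB := GJ _ GB.
exists (g B); first by exists B.
by have := ppP _ (SigSub (mem_set JB)) AB; rewrite -gE.
Qed.

Lemma tukey_non_family (Y : set T) :
  tukey_le (Cv I) (Cv J) -> ~ ideal_sets I Y ->
  exists2 Z : set U, ~ ideal_sets J Z & Z #<= Y.
Proof.
move=> [/= pm [pp ppP]] YI; exists (pm @` Y); last exact: card_image_le.
move=> JZ; apply: YI.
apply: (@ideal_subset _ _ _ (val (pp (SigSub (mem_set JZ))))).
  by move=> x Yx; apply: ppP => /=; exists x.
by apply: set_mem; exact: (valP (pp _)).
Qed.

Lemma tukey_cov_family (G : set (set U)) :
  tukey_le (Cv I) (Cv J) -> G `<=` ideal_sets J -> \bigcup_(A in G) A = setT ->
  exists2 F : set (set T), F `<=` ideal_sets I /\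
    \bigcup_(A in F) A = setT & F #<= G.
Proof.
move=> [/= pm [pp ppP]] GJ Gcov.
have [g gI gE] := set_type_fun pp set0.
exists (g @` G); last exact: card_image_le.
split=> [_ [A /GJ JA <-]|]; first exact: gI.
rewrite -subTset => x _.
have [B GB Bx] : (\bigcup_(A in G) A) (pm x) by rewrite Gcov.
have JB := GJ _ GB; exists (g B); first by exists B.
by have := ppP x (SigSub (mem_set JB)) Bx; rewrite -gE.
Qed.

End tukey_cardinals.

(** * Isomorphisms of ideals modulo null sets *)

Definition null_iso {T U : Type} (I : ideal T) (J : ideal U) :=
  exists (f : T -> U) (g : U -> T),
    [/\ forall B, ideal_sets J B -> ideal_sets I (f @^-1` B),
        forall A, ideal_sets I A -> ideal_sets J (g @^-1` A),
        ideal_sets I [set x | g (f x) <> x]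
      & ideal_sets J [set y | f (g y) <> y]].

Lemma null_iso_sym {T U : Type} {I : ideal T} {J : ideal U} :
  null_iso I J -> null_iso J I.
Proof. by move=> [f [g [? ? ? ?]]]; exists g, f. Qed.

Lemma null_iso_trans {T U V : Type} {I : ideal T} {J : ideal U} {K : ideal V} :
  null_iso I J -> null_iso J K -> null_iso I K.
Proof.
move=> [f1 [g1 [f1I g1J gf1 fg1]]] [f2 [g2 [f2J g2K gf2 fg2]]].
exists (f2 \o f1), (g1 \o g2); split=> [B KB|A IA||].
- by rewrite comp_preimage; apply: f1I; exact: f2J.
- by rewrite comp_preimage; apply: g2K; exact: g1J.
(* The composite round trip can fail only where the inner one fails at [f1 x] or the outer one fails
   at [x]. *)
- apply: ideal_subset (ideal_setU gf1 (f1I _ gf2)) => x /=.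
  move=> nx; apply: contrapT => /not_orP[/= /contrapT x1 /contrapT x2].
  by rewrite x2 in nx.
- apply: ideal_subset (ideal_setU fg2 (g2K _ fg1)) => x /=.
  move=> nx; apply: contrapT => /not_orP[/= /contrapT x1 /contrapT x2].
  by rewrite x2 in nx.
Qed.

Lemma null_iso_eq {T : Type} {I J : ideal T} :
  (forall A, ideal_sets I A <-> ideal_sets J A) -> null_iso I J.
Proof.
move=> IJ; exists id, id; split.
- by move=> B /IJ.
- by move=> A /IJ.
- by apply: ideal_subset (ideal_set0 _) => x /(_ erefl).
- by apply: ideal_subset (ideal_set0 _) => x /(_ erefl).
Qed.

Lemma null_iso_tukey_le {T U : Type} {I : ideal T} {J : ideal U} :
  null_iso I J -> tukey_le (ideal_relsys I) (ideal_relsys J).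
Proof.
move=> [f [g [fI gJ gf fg]]].
exists (fun A => SigSub (mem_set (gJ _ (set_mem (valP A))))).
exists (fun B => SigSub (mem_set (ideal_setU (fI _ (set_mem (valP B))) gf))).
move=> A B /= AB x Ax; have [gfx|] := pselect (g (f x) = x); last by right.
by left; apply: AB => /=; rewrite gfx.
Qed.

Lemma null_iso_tukey_le_Cv {T U : pointedType} {I : ideal T} {J : ideal U} :
  null_iso I J -> tukey_le (Cv I) (Cv J).
Proof.
move=> [f [g [fI gJ gf fg]]].
by exists f, (fun B => SigSub (mem_set (fI _ (set_mem (valP B))))).
Qed.

(** The conditions on [J] make the classes of families nonempty, so that the minima exist: the
    singletons witness add and cov, the whole space witnesses non, and [J] itself witnesses cof. *)
Lemma null_iso_invariants {T U : pointedType} {I : ideal T} {J : ideal U} :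
  null_iso I J -> ~ ideal_sets J setT -> (forall y, ideal_sets J [set y]) ->
  [/\ tukey_eq (ideal_relsys I) (ideal_relsys J)
    , tukey_eq (Cv I) (Cv J)
    & [/\ exists kappa : set (set U), is_add I kappa /\ is_add J kappa
        , exists kappa : set (set U), is_cof I kappa /\ is_cof J kappa
        , exists kappa : set U, is_non I kappa /\ is_non J kappa
        & exists kappa : set (set U), is_cov I kappa /\ is_cov J kappa]].
Proof.
move=> IJ JT J1; have JI := null_iso_sym IJ.
have IJt := null_iso_tukey_le IJ; have JIt := null_iso_tukey_le JI.
have IJc := null_iso_tukey_le_Cv IJ; have JIc := null_iso_tukey_le_Cv JI.
have cover1 : \bigcup_(A in range (@set1 U)) A = setT.
  by rewrite -subTset => y _; exists [set y] => //; exists y.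
split=> //; split; apply: exists_common_min_card.
- by exists (range (@set1 U)); split; [move=> _ [y _ <-]|rewrite cover1].
- by move=> F [FJ FnJ]; exact: tukey_add_family JIt FJ FnJ.
- by move=> F [FJ FnJ]; exact: tukey_add_family IJt FJ FnJ.
- by exists (ideal_sets J); split=> // A JA; exists A.
- by move=> F [FJ Fc]; exact: tukey_cof_family IJt FJ Fc.
- by move=> F [FJ Fc]; exact: tukey_cof_family JIt FJ Fc.
- by exists setT.
- by move=> F FJ; exact: tukey_non_family JIc FJ.
- by move=> F FJ; exact: tukey_non_family IJc FJ.
- by exists (range (@set1 U)); split => // _ [y _ <-].
- by move=> F [FJ Fc]; exact: tukey_cov_family IJc FJ Fc.
- by move=> F [FJ Fc]; exact: tukey_cov_family JIc FJ Fc.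
Qed.

(** * Reduction to atomless probabilities on the line *)

(** Cut the space into countably many pieces of finite measure, sum the restrictions of [mu] with
    positive weights that make the total finite, and normalize. *)
Lemma exists_equivalent_probability {d : measure_display} {T : measurableType d}
    {R : realType} (mu : {measure set T -> \bar R}) :
  sigma_finite [set: T] mu -> (0 < mu [set: T])%E ->
  exists P : probability T R, forall A, measurable A -> P A = 0%E <-> mu A = 0%E.
Proof.
move=> [F TF /all_and2[mF Foo]] mu0.
(* The summand [1] keeps [c n] positive even if [F n] is null. Dividing by [c n] bounds the mass of
   the [n]-th piece by [2^-(n+1)], so the total is at most 1. *)
pose c n : R := 1 + fine (mu (F n)).
have c0 n : 0 < c n by rewrite ltr_wpDr// fine_ge0.
pose w n : R := 1 / (2 ^ n.+1)%:R / c n.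
have w0 n : 0 < w n by rewrite !divr_gt0// ltr0n expn_gt0.
pose m_ n : {measure set T -> \bar R} :=
  mscale (NngNum (ltW (w0 n))) (mrestr mu (mF n)).
have m_E n A : m_ n A = ((w n)%:E * mu (A `&` F n))%E by [].
pose m := mseries m_ 0.
have m_eq0 A : measurable A -> m A = 0%E <-> mu A = 0%E.
  move=> mA; split=> [mA0|muA0].
    apply/(negligibleP _ mA).
    rewrite -(setIT A) TF setI_bigcupr; apply: negligible_bigcup => n.
    apply/negligibleP; first exact: measurableI.
    apply/eqP; rewrite -measure_le0 leNgt; apply/negP => muAF.
    have : (0 < m A)%E.
      apply: (@lt_le_trans _ _ (\sum_(0 <= k < n.+1) m_ k A)%E); last first.
        by apply: nneseries_lim_ge => k _ _; exact: measure_ge0.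
      rewrite big_nat_recr//=.
      apply: lt_le_trans (_ : (_ <= _ + m_ n A)%E); last first.
        by apply: leeDr; apply: sume_ge0 => k _; exact: measure_ge0.
      by rewrite m_E mule_gt0 ?lte_fin.
    by rewrite mA0 ltxx.
  rewrite /m /mseries eseries0// => n _ _; rewrite m_E.
  suff -> : mu (A `&` F n) = 0%E by rewrite mule0.
  by apply/eqP; rewrite -measure_le0 -muA0 le_measure ?inE//; exact: measurableI.
have mToo : (m setT < +oo)%E.
  apply: (@le_lt_trans _ _ 1%:E); last exact: ltry.
  apply: le_trans (epsilon_trick0 xpredT ler01).
  apply: lee_nneseries => [n _ _|n _]; first exact: measure_ge0.
  have Ffin : mu (F n) \is a fin_num by rewrite ge0_fin_numE.
  rewrite m_E setTI -(fineK Ffin) -EFinM lee_fin/= /w -[leLHS]mulrA; apply: ler_piMr.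
    by rewrite divr_ge0.
  by rewrite mulrC ler_pdivrMr// mul1r lerDr.
have mT0 : m setT != 0%E.
  by apply/eqP => /(m_eq0 _ measurableT) muT0; rewrite muT0 ltxx in mu0.
(* [dirac point] is the default of [mnormalize] for zero or infinite mass, cases excluded by [mT0]
   and [mToo]. *)
exists (mnormalize m (dirac point)) => A mA; apply: iff_trans (m_eq0 _ mA).
suff : mnormalize m (dirac point) A = 0%E <-> m A = 0%E by [].
have -> : mnormalize m (dirac point) A = (m A * ((fine (m setT))^-1)%:E)%E.
  by rewrite /mnormalize (negbTE mT0) (lt_eqF mToo).
have mTinv0 : ((fine (m setT))^-1)%:E != 0%E.
  by rewrite eqe invr_eq0 fine_eq0// ge0_fin_numE.
split=> [/eqP|->]; last by rewrite mul0e.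
by rewrite mule_eq0 (negbTE mTinv0) orbF => /eqP.
Qed.

(** Kept as a measure on the whole line, with a null set outside ]0, 1[, so that maps to and from it
    need no subtype. *)
Definition unit_lebesgue {R : realType} : set (measurableTypeR R) -> \bar R :=
  mrestr (@lebesgue_measure R) (measurable_itv `]0, 1[).

HB.instance Definition _ (R : realType) := Measure.on (@unit_lebesgue R).

Lemma unit_lebesgueT (R : realType) : @unit_lebesgue R setT = 1%E.
Proof.
rewrite /unit_lebesgue /mrestr setTI lebesgue_measure_itv/= lte_fin ltr01.
by rewrite oppr0 adde0.
Qed.

HB.instance Definition _ (R : realType) :=
  Measure_isProbability.Build _ _ _ (@unit_lebesgue R) (@unit_lebesgueT R).

(** * Distribution and quantile functions of an atomless probability *)

Section quantile.
Context {R : realType} (P : probability (measurableTypeR R) R).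
Hypothesis P_atomless : forall x : R, P [set x] = 0%E.

(** Open half-lines make [F] left-continuous, and they are the generators on which [distributionG]
    compares measures. *)
Let F (r : R) : R := fine (P `]-oo, r[%classic).

Let PE (r : R) : P `]-oo, r[%classic = (F r)%:E.
Proof. by rewrite fineK// fin_num_measure. Qed.

Let F_ge0 r : 0 <= F r.
Proof. by rewrite fine_ge0. Qed.

Let F_le1 r : F r <= 1.
Proof. by rewrite -lee_fin -PE probability_le1. Qed.

Let F_nd : {homo F : r s / r <= s}.
Proof.
move=> r s rs; rewrite -lee_fin -!PE le_measure ?inE//.
exact: subset_itvl.
Qed.

Let F_low t : 0 < t -> exists r, F r <= t.
Proof.
move=> t0; apply: contrapT => /forallNP Ft.
have : P `]-oo, (- n%:R)%R[%classic @[n --> \oo] -->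
    P (\bigcap_n `]-oo, (- n%:R)%R[%classic).
  apply: nonincreasing_cvg_mu => //.
  - by rewrite -ge0_fin_numE// fin_num_measure.
  - exact: bigcap_measurable.
  - move=> m n mn; apply/subsetPset; apply: subset_itvl.
    by rewrite bnd_simp lerN2 ler_nat.
rewrite (_ : \bigcap_n _ = set0); last first.
  rewrite -subset0 => x /(_ (Num.truncn (- x)).+1 I)/=.
  by rewrite in_itv/= ltrNr ltNge (ltW (truncnS_gt _)).
rewrite measure0 => cv.
suff : (t%:E <= 0)%E by rewrite lee_fin leNgt t0.
apply: (cvge_ge _ cv) => //; apply: nearW => n; rewrite PE lee_fin ltW// ltNge.
exact/negP.
Qed.

Let F_high t : t < 1 -> exists r, t < F r.
Proof.
move=> t1; apply: contrapT => /forallNP Ft.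
have : P `]-oo, n%:R[%classic @[n --> \oo] --> P (\bigcup_n `]-oo, n%:R[%classic).
  apply: nondecreasing_cvg_mu => //.
  - exact: bigcup_measurable.
  - move=> m n mn; apply/subsetPset; apply: subset_itvl.
    by rewrite bnd_simp ler_nat.
rewrite (_ : \bigcup_n _ = setT); last first.
  rewrite -subTset => x _; exists (Num.truncn x).+1 => //=.
  by rewrite in_itv/= truncnS_gt.
rewrite probability_setT => cv.
suff : (1%:E <= t%:E)%E by rewrite lee_fin leNgt t1.
apply: (cvge_le _ cv) => //; apply: nearW => n; rewrite PE lee_fin leNgt.
exact/negP.
Qed.

Let F_left c t : (forall r, r < c -> F r <= t) -> F c <= t.
Proof.
move=> Ft; rewrite -lee_fin -PE.
have -> : `]-oo, c[%classic = \bigcup_n `]-oo, c - n.+1%:R^-1[%classic.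
  apply/seteqP; split=> x /=; last first.
    by move=> [n _ /=]; rewrite !in_itv/= => /lt_le_trans; apply; rewrite gerBl.
  rewrite in_itv/= => xc.
  have /ltr_add_invr[n xn] : x < c by [].
  by exists n => //=; rewrite in_itv/= ltrBrDr.
apply: (cvge_le _ (nondecreasing_cvg_mu _ _ _)) => //.
- by apply: nearW => n /=; rewrite PE lee_fin Ft// ltrBlDr ltrDl.
- exact: bigcup_measurable.
- move=> m n mn; apply/subsetPset; apply: subset_itvl.
  by rewrite bnd_simp lerD2l lerN2 lef_pV2 ?posrE// ler_nat.
Qed.

(** Atomlessness enters here: the half-line may be closed at [c] without changing its measure, and
    is then a decreasing intersection of open half-lines. *)
Let F_right c t : (forall r, c < r -> t <= F r) -> t <= F c.
Proof.
move=> Ft; rewrite -lee_fin -PE.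
have -> : P `]-oo, c[%classic = P `]-oo, c]%classic.
  rewrite -[in RHS](@setUitv1 _ _ -oo%O c true)// measureU//= ?P_atomless ?adde0//.
  by apply/seteqP; split => // x [/= + xc]; rewrite xc in_itv/= ltxx.
have -> : `]-oo, c]%classic = \bigcap_n `]-oo, c + n.+1%:R^-1[%classic.
  apply/seteqP; split=> x /=.
    by rewrite in_itv/= => xc n _ /=; rewrite in_itv/= (le_lt_trans xc)// ltrDl.
  move=> xn; rewrite in_itv/= leNgt; apply/negP => /ltr_add_invr[n cx].
  by have := xn n I; rewrite /= in_itv/= ltNge (ltW cx).
apply: (cvge_ge _ (nonincreasing_cvg_mu _ _ _ _)) => //.
- by apply: nearW => n /=; rewrite PE lee_fin Ft// ltrDl.
- by rewrite -ge0_fin_numE// fin_num_measure.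
- exact: bigcap_measurable.
- move=> m n mn; apply/subsetPset; apply: subset_itvl.
  by rewrite bnd_simp lerD2l lef_pV2 ?posrE// ler_nat.
Qed.

(** The value 0 off ]0, 1[ is a default taken on a null set; it causes the case distinction on
    [0 < x] in [preimageG]. *)
Let G (t : R) : R := if 0 < t < 1 then sup [set r | F r <= t] else 0.

(** A Galois connection: by left-continuity the supremum [G t] is attained, so the set where
    [F r <= t] is the closed half-line up to [G t]. *)
Let G_gt t r : 0 < t < 1 -> (G t < r) = (t < F r).
Proof.
move=> t01; rewrite /G t01; move/andP: t01 => [t0 t1].
have [r0 r0t] := F_low _ t0; have [r1 tr1] := F_high _ t1.
have Dsup : has_sup [set r | F r <= t].
  split; first by exists r0.
  exists r1 => s /= st; rewrite leNgt; apply/negP => /ltW/F_nd.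
  by rewrite leNgt (le_lt_trans st).
rewrite !ltNge; congr negb; apply/idP/idP => [rG|]; last first.
  by move=> rt; apply: ub_le_sup => //; exact: (proj2 Dsup).
apply: le_trans (F_nd _ _ rG) _; apply: F_left => s sG.
have [u ut su] := sup_gt (proj1 Dsup) sG.
exact: le_trans (F_nd _ _ (ltW su)) ut.
Qed.

Let FG t : 0 < t < 1 -> F (G t) = t.
Proof.
move=> t01; apply/le_anti/andP; split.
  by rewrite leNgt -G_gt// ltxx.
by apply: F_right => r; rewrite G_gt// => /ltW.
Qed.

Let preimageG x : G @^-1` `]-oo, x[ =
  `]0, F x[ `|` (~` `]0, 1[ `&` (if 0 < x then setT else set0)).
Proof.
apply/seteqP; split=> t /=; rewrite !in_itv/=.
  have [t01|nt01] := boolP (0 < t < 1).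
    by rewrite G_gt// => tF; left; case/andP: t01 => ->.
  by rewrite /G (negbTE nt01) => ->; right; split => //; exact/negP.
move=> [/andP[t0 tF]|[/negP nt01]].
  by rewrite G_gt// t0 (lt_le_trans tF).
by rewrite /G (negbTE nt01); case: (0 < x).
Qed.

Let measurableG : measurable_fun [set: measurableTypeR R] (G : _ -> measurableTypeR R).
Proof.
apply: (measurability _ (RGenInftyO.measurableE R)) => _ [_ [x ->] <-].
rewrite setTI preimageG; apply: measurableU => //; apply: measurableI.
  exact: measurableC.
by case: ifP.
Qed.

Let measurableF : measurable_fun [set: measurableTypeR R] (F : _ -> measurableTypeR R).
Proof. by apply: nondecreasing_measurable => // r s; exact: F_nd. Qed.

#[local] HB.instance Definition _ :=
  @isMeasurableFun.Build _ _ _ _ (G : measurableTypeR R -> measurableTypeR R) measurableG.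

Let unit_lebesgue_compl : @unit_lebesgue R (~` `]0, 1[%classic) = 0%E.
Proof. by rewrite /unit_lebesgue/= /mrestr setICl measure0. Qed.

(** Both sides are finite measures that agree on open half-lines, a generating class closed under
    intersection: within ]0, 1[ the preimage of the half-line below [x] is cut out by [t < F x]. *)
Let distributionG A : measurable A -> unit_lebesgue (G @^-1` A) = P A.
Proof.
move=> mA.
apply: (@measure_unique _ R (measurableTypeR R) (@RGenInftyO.G R)
  (fun n => `]-oo, n%:R[%classic) _ _ _ _ (distribution unit_lebesgue G) P) => //.
- exact: RGenInftyO.measurableE.
- move=> _ _ [x ->] [y ->]; exists (Order.min x y).
  by apply/seteqP; split => t /=; rewrite !in_itv/= lt_min => /andP.
- by move=> n; exists n%:R.
- rewrite -subTset => x _; exists (Num.truncn x).+1 => //=.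
  by rewrite in_itv/= truncnS_gt.
- move=> _ [x ->]; transitivity (F x)%:E; last exact/esym/PE.
  transitivity (unit_lebesgue (G @^-1` `]-oo, x[)) => //.
  rewrite preimageG /unit_lebesgue /mrestr setIUl setIAC setICl set0I setU0.
  rewrite (setIidl (B := `]0, 1[%classic)).
    rewrite lebesgue_measure_itv/= lte_fin oppr0 adde0.
    (* If [F x = 0] the interval is empty, and the other branch of the length formula also gives
       0. *)
    by rewrite lt_def F_ge0 andbT; case: eqVneq => //= ->.
  by apply: subset_itvl; rewrite bnd_simp.
- by move=> n; rewrite -ge0_fin_numE// fin_num_measure.
Qed.

Lemma null_iso_unit_lebesgue :
  null_iso (null_ideal P) (null_ideal (@unit_lebesgue R)).
Proof.
have mF C : measurable C -> measurable (F @^-1` C).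
  by move=> mC; rewrite -[X in measurable X]setTI; exact: measurableF.
have mG C : measurable C -> measurable (G @^-1` C).
  by move=> mC; rewrite -[X in measurable X]setTI; exact: measurableG.
exists F, G; split.
- move=> B [C [mC C0 BC]]; exists (F @^-1` C).
  split; [exact: mF| |exact: preimage_subset].
  (* On ]0, 1[ the map [F \o G] is the identity, so this double preimage exceeds [C] only off ]0,
     1[. *)
  transitivity (unit_lebesgue (G @^-1` (F @^-1` C))).
    by apply: esym; apply: distributionG; exact: mF.
  apply: (subset_measure0 (B := C `|` ~` `]0, 1[%classic)).
  + exact: (mG _ (mF _ mC)).
  + by apply: measurableU => //; exact: measurableC.
  + move=> t /=; rewrite in_itv/=; have [t01|/negP nt01] := boolP (0 < t < 1).
      by rewrite FG//; left.
    by right.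
  + by apply: null_set_setU => //; exact: measurableC.
- move=> A [C [mC C0 AC]]; exists (G @^-1` C).
  split; [exact: mG| |exact: preimage_subset].
  by rewrite -[RHS]C0; exact: distributionG.
- have mD : measurable [set r | G (F r) <> r].
    rewrite (_ : mkset _ = (fun r => G (F r) - r) @^-1` (~` [set 0])).
      rewrite -[X in measurable X]setTI; apply: measurable_funB => //.
      - exact: (measurableT_comp measurableG measurableF).
      - exact: measurableC.
    apply/seteqP; split=> r /=; apply: contra_not; last by move=> ->; rewrite subrr.
    by move/eqP; rewrite subr_eq0 => /eqP.
  exists [set r | G (F r) <> r]; split => //.
  (* For [t] in ]0, 1[, [F (G t) = t] gives [G (F (G t)) = G t]: the preimage under [G] of the bad
     set misses ]0, 1[. *)
  transitivity (unit_lebesgue (G @^-1` [set r | G (F r) <> r])).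
    by apply: esym; exact: distributionG.
  apply: (subset_measure0 _ _ _ unit_lebesgue_compl).
  + exact: mG.
  + exact: measurableC.
  + by move=> t /=; rewrite in_itv/= => GFG; apply: contra_not GFG => /FG ->.
- exists (~` `]0, 1[%classic); split => //.
    exact: measurableC.
  by move=> t /= nt; rewrite in_itv/= => t01; exact/nt/FG.
Qed.
End quantile.

(** * Coding a Polish space by reals *)

Section ternary.
Context {R : realType}.
Implicit Types (s : nat -> bool) (x : R).

(** The sum starts at [3^0], so all values lie in [0, 3/2] and the tail after the first digit is at
    most 1/2. Hence the first digit is 1 exactly when the value is at least 1, and expansions are
    unique. *)
Let partial s n : R := \sum_(i < n) (s i)%:R / 3 ^+ i.

Definition ternary s : R := limn (partial s).

Let partialS s n : partial s n.+1 = (s 0)%:R + partial (s \o succn) n / 3.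
Proof.
rewrite /partial big_ord_recl/= expr0 divr1; congr (_ + _).
by rewrite mulr_suml; apply: eq_bigr => i _; rewrite -mulrA -invfM exprSr.
Qed.

Let partial_ge0 s n : 0 <= partial s n.
Proof. by apply: sumr_ge0 => i _; rewrite divr_ge0// exprn_ge0. Qed.

Let partial_le s n : partial s n <= 3 / 2.
Proof.
elim: n s => [|n IH] s; first by rewrite /partial big_ord0; lra.
rewrite partialS; have := IH (s \o succn).
by case: (s 0) => /=; lra.
Qed.

Let partial_cvg s : partial s @ \oo --> ternary s.
Proof.
apply: nondecreasing_is_cvgn.
  apply/nondecreasing_seqP => n.
  by rewrite /partial big_ord_recr/= lerDl divr_ge0// exprn_ge0.
by exists (3 / 2) => _ [n _ <-]; exact: partial_le.
Qed.

Let ternary_ge0 s : 0 <= ternary s.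
Proof. by apply: limr_ge; [exact: partial_cvg|exact: nearW]. Qed.

Let ternary_le s : ternary s <= 3 / 2.
Proof. by apply: limr_le; [exact: partial_cvg|exact: nearW]. Qed.

Let ternaryS s : ternary s = (s 0)%:R + ternary (s \o succn) / 3.
Proof.
have := @partial_cvg s; rewrite -cvg_shiftS => /cvg_lim <-//.
apply: cvg_lim => //.
rewrite (_ : (fun n => _) = (fun n => (s 0)%:R + partial (s \o succn) n / 3)).
  by apply: cvgD; [exact: cvg_cst|apply: cvgMl; exact: partial_cvg].
by apply/funext => n; rewrite partialS.
Qed.

(** Drops the leading digit and rescales: on [ternary s] it gives the value of the tail of [s]. *)
Let shift x : R := 3 * (x - (1 <= x)%R%:R).

Definition ternary_digit n x := 1 <= iter n shift x.

Let ternary_ge1 s : (1 <= ternary s) = s 0.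
Proof.
have := ternary_ge0 (s \o succn); have := ternary_le (s \o succn).
rewrite (ternaryS s); case: (s 0) => /= le32 ge0; first by lra.
by apply/negbTE; rewrite -ltNge; lra.
Qed.

Lemma ternaryK s n : ternary_digit n (ternary s) = s n.
Proof.
rewrite /ternary_digit; elim: n s => [|n IH] s; first exact: ternary_ge1.
rewrite iterSr (_ : shift _ = ternary (s \o succn)) ?IH//.
by rewrite /shift ternary_ge1 ternaryS addrC addKr mulrC divfK.
Qed.

Lemma measurable_ternary_digit n : measurable [set x | ternary_digit n x].
Proof.
have mshift : measurable_fun setT shift.
  apply: measurable_funM => //; apply: measurable_funB => //.
  rewrite (_ : (fun x => _) = \1_`[1, +oo[).
    exact: measurable_indic.
  by apply/funext => x; rewrite indicE mem_setE in_itv/= andbT.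
have miter : measurable_fun setT (iter n shift).
  by elim: n => [|n IH]; [exact: measurable_id|exact: (measurableT_comp mshift IH)].
rewrite (_ : mkset _ = iter n shift @^-1` `[1, +oo[).
  by rewrite -[X in measurable X]setTI; exact: miter.
by apply/seteqP; split => x /=; rewrite in_itv/= andbT.
Qed.

Lemma measurable_ternary {d : measure_display} {T : measurableType d}
    (s : T -> nat -> bool) :
  (forall n, measurable [set t | s t n]) ->
  measurable_fun setT (fun t => ternary (s t)).
Proof.
move=> ms; apply: (@measurable_fun_cvg _ _ _ _ (fun n t => partial (s t) n)).
  move=> n; rewrite /partial; apply: measurable_sum => i.
  apply: measurable_funM => //.
  rewrite (_ : (fun t => (s t i)%:R) = \1_[set t | s t i]).
    exact: measurable_indic.
  apply/funext => t; rewrite indicE.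
  by case: (boolP (s t i)) => [|/negP] st; [rewrite mem_set|rewrite memNset].
by move=> t _; exact: partial_cvg.
Qed.

End ternary.

(** * Transport of a probability along a Borel embedding *)

Section embedding.
Context {d1 d2 : measure_display} {T : measurableType d1} {U : measurableType d2}
  {R : realType} (P : probability T R) (f : {mfun T >-> U}).

Lemma null_iso_distribution :
  injective f -> measurable (range f) ->
  (forall A, measurable A -> exists2 B, measurable B & A = f @^-1` B) ->
  null_iso (null_ideal P) (null_ideal (distribution P f)).
Proof.
move=> finj mf fB.
have mf' B : measurable B -> measurable (f @^-1` B).
  by move=> mB; rewrite -[X in measurable X]setTI; exact: measurable_funPT.
have range0 : distribution P f (~` range f) = 0%E.
  rewrite /distribution /pushforward (_ : _ @^-1` _ = set0) ?measure0//.
  by rewrite -subset0 => x; apply; exists x.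
have /choice[g gf] : forall y, exists x, range f y -> f x = y.
  move=> y; have [[x _ fx]|nfy] := pselect (range f y); first by exists x.
  by exists point.
have gK : cancel f g by move=> x; apply: finj; apply: gf; exists x.
exists f, g; split.
- move=> B [C [mC C0 BC]]; exists (f @^-1` C); split => //; first exact: mf'.
  exact: preimage_subset.
- move=> A [A' [mA' A'0 AA']]; have [B mB A'E] := fB _ mA'.
  exists (B `|` ~` range f); split.
  + by apply: measurableU => //; exact: measurableC.
  + apply: null_set_setU => //; first exact: measurableC.
    by rewrite -A'0 A'E.
  + move=> y /= Agy; have [fy|] := pselect (range f y); last by right.
    by left; have := AA' _ Agy; rewrite A'E/= gf.
- by apply: ideal_subset (ideal_set0 _) => x /= []; exact: gK.
- exists (~` range f); split => //; first exact: measurableC.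
  by move=> y /= gfy fy; exact/gfy/gf.
Qed.

End embedding.

(** * Measurability of countable logical combinations *)

Section measurable_formulas.
Context {d : measure_display} {T : measurableType d}.
Implicit Types A B : T -> Prop.

Lemma measurable_forall_nat (A : nat -> T -> Prop) :
  (forall n, measurable [set t | A n t]) -> measurable [set t | forall n, A n t].
Proof.
move=> mA; rewrite (_ : mkset _ = \bigcap_n [set t | A n t]).
  exact: bigcapT_measurable.
by apply/seteqP; split => [t At n _|t At n]; exact: At.
Qed.

Lemma measurable_exists_nat (A : nat -> T -> Prop) :
  (forall n, measurable [set t | A n t]) -> measurable [set t | exists n, A n t].
Proof.
move=> mA; rewrite (_ : mkset _ = \bigcup_n [set t | A n t]).
  exact: bigcupT_measurable.
by apply/seteqP; split => t [n]; [exists n|move=> _; exists n].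
Qed.

Lemma measurable_prop (Q : Prop) : measurable [set t : T | Q].
Proof.
have [q|nq] := pselect Q.
  by rewrite (_ : mkset _ = setT)//; apply/seteqP; split.
by rewrite (_ : mkset _ = set0)//; apply/seteqP; split.
Qed.

Lemma measurable_imply A B : measurable [set t | A t] ->
  measurable [set t | B t] -> measurable [set t | A t -> B t].
Proof.
move=> mA mB; rewrite (_ : mkset _ = ~` [set t | A t] `|` [set t | B t]).
  by apply: measurableU => //; exact: measurableC.
apply/seteqP; split => t /=.
  by move=> AB; have [/AB|] := pselect (A t); [right|left].
by move=> [nA /nA|].
Qed.

End measurable_formulas.

(** * Borel embedding of a Polish space into the line *)

Section polish_embedding.
Context {R : realType} {X : ptopologicalType} (d : X -> X -> R).
Hypotheses (d_metric : is_metric d) (d_top : induces_topology d).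

Let d_ge0 x y : 0 <= d x y. Proof. by case: d_metric. Qed.
Let d_eq0 x y : d x y = 0 <-> x = y. Proof. by case: d_metric. Qed.
Let d_sym x y : d x y = d y x. Proof. by case: d_metric. Qed.
Let d_tri x y z : d x z <= d x y + d y z. Proof. by case: d_metric. Qed.

Lemma metric_ball_open x e : open [set y | d x y < e].
Proof.
rewrite openE => y /= xy; rewrite /interior d_top.
exists (e - d x y) => /=; first by rewrite subr_gt0.
by move=> z /= yz; rewrite (le_lt_trans (d_tri _ y _))// -ltrBrDl.
Qed.

Lemma separable_ball_sequence : separable X ->
  exists (c : nat -> X) (r : nat -> R),
    forall x e, 0 < e -> exists n, r n < e /\ d (c n) x < r n.
Proof.
move=> [S Scount Sdense].
have [q qS] : exists q : nat -> X, S `<=` range q.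
  have [S0|/set0P Sn0] := eqVneq S set0.
    by exists (fun=> point); rewrite S0.
  have /pfcard_geP[S0|[q]] := Scount; first by rewrite S0 in Sn0; case: Sn0.
  by exists q; exact: surj.
(* Indices that code no pair get radius 0, hence an empty ball. *)
pose cr n : X * R := if unpickle n is Some (i, k) then (q i, k.+1%:R^-1) else (point, 0).
exists (fun n => (cr n).1), (fun n => (cr n).2) => x e e0.
have /ltr_add_invr[k ke] := e0; rewrite add0r in ke.
have [y [/= xy /qS[i _ qi]]] : [set y | d x y < k.+1%:R^-1] `&` S !=set0.
  apply: Sdense; last exact: metric_ball_open.
  by exists x => /=; rewrite (proj2 (d_eq0 _ _)).
exists (pickle (i, k)); rewrite /cr pickleK/=; split => //.
by rewrite qi d_sym.
Qed.

Variables (c : nat -> X) (r : nat -> R).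
Hypothesis cr_dense : forall x e, 0 < e -> exists n, r n < e /\ d (c n) x < r n.

Let code (x : X) (n : nat) : bool := d (c n) x < r n.

(* Balls of small radius in [s] have Cauchy centers by the first two conditions;
   the third says that [s] is the set of all basic balls around the limit. Each
   condition is a countable combination of values of [s], hence Borel. *)
Let point_code (s : nat -> bool) : Prop :=
  (forall k, exists n, s n /\ r n < k.+1%:R^-1) /\
  (forall n m, s n -> s m -> d (c n) (c m) < r n + r m) /\
  (forall n, (s n -> exists m, s m /\ d (c n) (c m) + r m < r n) /\
    forall m, s m /\ d (c n) (c m) + r m < r n -> s n).

(** A ball around [x] of radius below half of [d x y] cannot contain [y]. *)
Let code_inj x y : code x = code y -> x = y.
Proof.
move=> xy; apply/d_eq0/eqP; rewrite eq_le d_ge0 andbT leNgt; apply/negP => dxy.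
have [|n [rn xn]] := cr_dense x (d x y / 2); first by lra.
have : code y n by rewrite -xy.
rewrite /code => yn; have := d_tri x (c n) y; rewrite (d_sym x (c n)); lra.
Qed.

Let code_point_code x : point_code (code x).
Proof.
split=> [k|]; first by have [|n [rn xn]] := cr_dense x k.+1%:R^-1; [|exists n].
split=> [n m|n].
  by rewrite /code => xn xm; have := d_tri (c n) x (c m); rewrite (d_sym x (c m)); lra.
rewrite /code; split=> [xn|m [xm nm]]; last first.
  have := d_tri (c n) (c m) x; lra.
(* Half the slack suffices, since [d (c n) (c m) + r m] is less than [d (c n) x + 2 * r m]. *)
have [|m [rm xm]] := cr_dense x ((r n - d (c n) x) / 2); first by lra.
exists m; split => //; have := d_tri (c n) x (c m); rewrite (d_sym x (c m)); lra.
Qed.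

Let point_code_code s : metric_complete d -> point_code s -> exists x, code x = s.
Proof.
move=> d_complete [/choice[v vP] [s_meet s_iff]].
have sv k : s (v k) by case: (vP k).
have rv k : r (v k) < k.+1%:R^-1 by case: (vP k).
have small (e : R) : 0 < e -> exists N, forall k, (N <= k)%N -> r (v k) < e.
  move=> e0; have [N Ne] := ltr_add_invr e0; exists N => k Nk.
  rewrite add0r in Ne; apply: lt_trans (rv k) (le_lt_trans _ Ne).
  by rewrite lef_pV2 ?posrE// ler_nat.
have [|x cvx] := d_complete (c \o v).
  move=> e e0; have [|N Ne] := small (e / 2); first by lra.
  exists N => m n Nm Nn /=; have := s_meet _ _ (sv m) (sv n).
  have := Ne _ Nm; have := Ne _ Nn; lra.
have near_x (e : R) N : 0 < e -> exists2 k, (N <= k)%N & d x (c (v k)) < e.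
  move=> e0; have : nbhs x [set y | d x y < e] by rewrite d_top; exists e.
  move=> /cvx [M _ Mx]; exists (maxn N M); first exact: leq_maxl.
  by apply: Mx => /=; exact: leq_maxr.
(* Passing to the limit only gives a weak inequality; the strict one is recovered below from a
   smaller ball of [s] well inside the given one. *)
have dx_le m : s m -> d (c m) x <= r m.
  move=> sm; apply/ler_addgt0Pr => e e0.
  have [|N Ne] := small (e / 2); first by lra.
  have [|k Nk xk] := near_x (e / 2) N; first by lra.
  have := d_tri (c m) (c (v k)) x; rewrite (d_sym (c (v k)) x).
  have := s_meet _ _ sm (sv k); have := Ne _ Nk; lra.
exists x; apply/funext => n; rewrite /code; apply/idP/idP => [xn|sn].
  have [|N Ne] := small ((r n - d (c n) x) / 2); first by lra.
  (* The ball [v N] is so small and so close to [x] that it lies well inside ball [n], which forces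
     [n] into [s]. *)
  apply: (proj2 (s_iff n) (v N)); split => //.
  have := d_tri (c n) x (c (v N)); have := dx_le _ (sv N).
  rewrite (d_sym (c (v N)) x).
  have := Ne _ (leqnn N); lra.
have [m [sm nm]] := proj1 (s_iff n) sn.
have := d_tri (c n) (c m) x; have := dx_le _ sm; lra.
Qed.

Definition polish_code (x : borelType X) : measurableTypeR R := ternary (code x).

Let ternary_code x n : ternary_digit n (polish_code x) = (d (c n) x < r n).
Proof. by rewrite /polish_code ternaryK. Qed.

Lemma polish_code_inj : injective polish_code.
Proof.
move=> x y xy; apply: code_inj; apply/funext => n.
by rewrite /code -!ternary_code xy.
Qed.

Lemma measurable_polish_code : measurable_fun [set: borelType X] polish_code.
Proof.
apply: measurable_ternary => n; apply: sub_sigma_algebra.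
exact: metric_ball_open.
Qed.

Lemma measurable_range_polish_code : metric_complete d ->
  measurable (range polish_code).
Proof.
move=> d_complete.
have mdigit n : measurable [set t : measurableTypeR R | ternary_digit n t : Prop].
  exact: measurable_ternary_digit.
(* Digits are defined for every real, so the second set is needed to discard reals that are not the
   value of their own digits. *)
rewrite (_ : range _ = [set t : measurableTypeR R | point_code (ternary_digit^~ t)] `&`
    [set t | ternary (ternary_digit^~ t) = t :> R]); last first.
  apply/seteqP; split=> t /=.
    move=> [x _ <-]; have -> : ternary_digit^~ (polish_code x) = code x.
      by apply/funext => n; rewrite ternary_code.
    by split; first exact: code_point_code.
  move=> [/(point_code_code _ d_complete)[x xt] tt]; exists x => //.
  by rewrite /polish_code xt.
have mlt x y : measurable (fun _ : measurableTypeR R => x < y :> R).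
  exact: measurable_prop.
apply: measurableI; first (apply: measurableI; last apply: measurableI).
- apply: measurable_forall_nat => k; apply: measurable_exists_nat => n.
  by apply: measurableI; [exact: mdigit|exact: mlt].
- apply: measurable_forall_nat => n; apply: measurable_forall_nat => m.
  apply: measurable_imply; first exact: mdigit.
  by apply: measurable_imply; [exact: mdigit|exact: mlt].
- apply: measurable_forall_nat => n; apply: measurableI.
    apply: measurable_imply; first exact: mdigit.
    apply: measurable_exists_nat => m.
    by apply: measurableI; [exact: mdigit|exact: mlt].
  apply: measurable_forall_nat => m.
  apply: measurable_imply; last exact: mdigit.
  by apply: measurableI; [exact: mdigit|exact: mlt].
have mt : measurable_fun setT
    (fun t : measurableTypeR R => ternary (ternary_digit^~ t) - t : R).
  by apply: measurable_funB => //; exact: measurable_ternary.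
rewrite (_ : mkset _ = (fun t => ternary (ternary_digit^~ t) - t) @^-1` [set 0]).
  by rewrite -[X in measurable X]setTI; exact: mt.
apply/seteqP; split=> t /=; first by move=> ->; rewrite subrr.
by move/eqP; rewrite subr_eq0 => /eqP.
Qed.

(** Preimages of Borel sets form a sigma-algebra, so open sets suffice. An open set is the union of
    the basic balls inside it, and ball [n] is the preimage of the reals whose [n]-th digit is 1. *)
Lemma borel_preimage_polish_code (A : set (borelType X)) : measurable A ->
  exists2 B, measurable B & A = polish_code @^-1` B.
Proof.
move=> mA.
suff : measurable `<=` preimage_set_system setT polish_code measurable.
  by move=> /(_ _ mA)[B mB <-]; exists B; rewrite ?setTI.
apply: smallest_sub.
  exact/sigma_algebra_preimage/sigma_algebra_measurable.
move=> U oU.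
exists (\bigcup_(n in [set n | [set x | d (c n) x < r n] `<=` U])
    [set t : R | ternary_digit n t]).
  by apply: bigcup_measurable => n _; exact: measurable_ternary_digit.
rewrite setTI; apply/seteqP; split=> x /=.
  move=> [n /= nU xn]; apply: nU => /=; exact: etrans (esym (ternary_code x n)) xn.
move=> Ux; move: oU; rewrite openE => /(_ _ Ux); rewrite /interior d_top.
move=> [e /= e0 eU]; have [|n [rn xn]] := cr_dense x (e / 2); first by lra.
exists n; last exact: etrans (ternary_code x n) xn.
move=> y /= yn; apply: eU => /=; have := d_tri x (c n) y; rewrite (d_sym x (c n)); lra.
Qed.

End polish_embedding.

(** * Comparison of both null ideals with the unit interval *)

Lemma null_iso_polish {R : realType} {X : ptopologicalType}
    (P : probability (borelType X) R) :
  polish R X -> free_measure P ->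
  null_iso (null_ideal P) (null_ideal (@unit_lebesgue R)).
Proof.
move=> [[d [d_metric d_top d_complete]] Xsep] P0.
have [c [r cr]] := separable_ball_sequence d d_metric d_top Xsep.
pose f := polish_code d c r.
have mf : measurable_fun setT f by exact: measurable_polish_code.
have finj : injective f by exact: polish_code_inj.
pose F : {mfun borelType X >-> measurableTypeR R} :=
  HB.pack f (isMeasurableFun.Build _ _ _ _ f mf).
apply: (@null_iso_trans _ _ _ _ (null_ideal (distribution P F))).
  apply: null_iso_distribution => //.
    exact: measurable_range_polish_code.
  exact: borel_preimage_polish_code.
apply: null_iso_unit_lebesgue => t.
(* The image measure has no atoms: by injectivity the preimage of a point is a singleton or
   empty. *)
have [[x _ xt]|nt] := pselect (range f t).
  transitivity (P [set x]); last by case: (P0 x).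
  by congr (P _); apply/seteqP; split=> y /=; [rewrite -xt => /finj|move=> ->].
transitivity (P set0); last exact: measure0.
by congr (P _); rewrite -subset0 => y /= yt; apply: nt; exists y.
Qed.

Lemma null_iso_free_measure {R : realType} {X : ptopologicalType}
    (mu : {measure set (borelType X) -> \bar R}) :
  polish R X -> free_measure mu -> sigma_finite [set: borelType X] mu ->
  (0 < mu [set: borelType X])%E ->
  null_iso (null_ideal mu) (null_ideal (@unit_lebesgue R)).
Proof.
move=> Xpolish mu_free mu_sfin mu_gt0.
have [P Pmu] := exists_equivalent_probability mu mu_sfin mu_gt0.
apply: (@null_iso_trans _ _ _ _ (null_ideal P)).
  apply: null_iso_eq => A.
  by split=> -[B [mB B0 AB]]; exists B; split => //; exact/(Pmu _ mB).
apply: null_iso_polish => // x; have [mx mux] := mu_free x.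
by split=> //; exact/(Pmu _ mx).
Qed.

Lemma lebesgue_measureT_gt0 {R : realType} : (0 < @lebesgue_measure R setT)%E.
Proof. by rewrite -set_itvNyy lebesgue_measure_itv/= ltry. Qed.

Lemma null_iso_lebesgue_measure {R : realType} :
  null_iso (null_ideal (@lebesgue_measure R)) (null_ideal (@unit_lebesgue R)).
Proof.
have [P Pleb] := exists_equivalent_probability _ (sigma_finiteT (@lebesgue_measure R))
  lebesgue_measureT_gt0.
apply: (@null_iso_trans _ _ _ _ (null_ideal P)).
  apply: null_iso_eq => A.
  by split=> -[B [mB B0 AB]]; exists B; split => //; exact/(Pleb _ mB).
apply: null_iso_unit_lebesgue => x.
by apply/(Pleb _ (measurable_set1 x)); exact: lebesgue_measure_set1.
Qed.

Theorem corollary7p9 (R : realType) (X : ptopologicalType)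
    (mu : {measure set (borelType X) -> \bar R}) :
  polish R X ->
  free_measure mu ->
  sigma_finite [set: borelType X] mu ->
  (0 < mu [set: borelType X])%E ->
  let Nmu := null_ideal mu in
  let NR := null_ideal (@lebesgue_measure R) in
  [/\ tukey_eq (ideal_relsys Nmu) (ideal_relsys NR)
    , tukey_eq (Cv Nmu) (Cv NR)
    & [/\ exists kappa : set (set R), is_add Nmu kappa /\ is_add NR kappa
        , exists kappa : set (set R), is_cof Nmu kappa /\ is_cof NR kappa
        , exists kappa : set R, is_non Nmu kappa /\ is_non NR kappa
        & exists kappa : set (set R), is_cov Nmu kappa /\ is_cov NR kappa]].
Proof.
move=> Xpolish mu_free mu_sfin mu_gt0 Nmu NR.
apply: null_iso_invariants.
- apply: null_iso_trans (null_iso_sym null_iso_lebesgue_measure).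
  exact: null_iso_free_measure.
- move=> /(measure_negligible measurableT) leb0.
  by have := @lebesgue_measureT_gt0 R; rewrite leb0 ltxx.
- by move=> y; exists [set y]; split => //; exact: lebesgue_measure_set1.
Qed.
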